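(* Let $n\ge 2$. Given any $n$-periodic sign function $\varepsilon$ and any $n$-periodic function $\pi:\mathbb{Z}\to\mathbb{R}$ of slope $\frac mn\neq0$ taking distinct values ($\pi(i)\ne\pi(j)$ for $i\neq j$), there is a unique $n$-periodic tree $\mathcal{T}$ with sign function $\varepsilon$ on which $\psi(p_i)=\pi(i)$ is an $n$-periodic morphism.
   Context: $\varepsilon:\mathbb{Z}\to\{+,-\}$ is $n$-periodic if $\varepsilon_{i+n}=\varepsilon_i$. An $n$-periodic poset is a set $P=\{p_i : i\in\mathbb{Z}\}$ (distinct $p_i$) with a partial order such that $p_i<p_j\Leftrightarrow p_{i+n}<p_{j+n}$. $p$ is a child of $q$ (and $q$ a parent of $p$) if $p<q$ and no $x$ satisfies $p<x<q$. The Hasse diagram is the directed graph with vertex set $P$ and an edge from each child to each of its parents; it is required that whenever $p<q$ there is a directed path from $p$ to $q$. An edge with endpoints $p_i,p_j$, $i<j$, is written $\ell=(p_i,p_j)$. It has positive slope if $p_i<p_j$ ($p_j$ is then a right parent of $p_i$, and $p_i$ a left child of $p_j$) and negative slope if $p_i>p_j$ ($p_j$ is a right child of $p_i$, and $p_i$ a left parent of $p_j$). An $n$-periodic tree with sign function $\varepsilon$ is the Hasse diagram $\mathcal{T}$ of an $n$-periodic poset $P=P_{\mathcal{T}}$ such that the underlying graph is a tree (connected, no cycles) and: (T1) each $p_i$ has at most one left parent, at most one right parent, at most one left child, at most one right child; (T2) if $\varepsilon_i=+$ then $p_i$ has at most one parent; (T3) if $\varepsilon_i=-$ then $p_i$ has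 at most one child; (T4) for every edge $(p_i,p_j)$ and every $i<k<j$: (a) if $p_k<p_i$ and $p_k<p_j$ then $\varepsilon_k=+$; (b) if $p_k>p_i$ and $p_k>p_j$ then $\varepsilon_k=-$. Two trees are considered the same if they define the same partial order on the indices. An $n$-periodic function is $\pi:\mathbb{Z}\to\mathbb{R}$ with $m=\pi(i+n)-\pi(i)$ independent of $i$; its slope is $m/n$. $\psi:P_{\mathcal{T}}\to\mathbb{R}$ is an $n$-periodic morphism if $i\mapsto\psi(p_i)$ is $n$-periodic and $\psi(p_i)<\psi(p_j)$ whenever $p_i<p_j$. *)

(* Defs.v *)
From Stdlib Require Import ZArith Reals List Relations RelationClasses Sorted.
Import ListNotations.
Local Open Scope Z_scope.

Inductive sign : Set := Plus | Minus.

Definition periodic_sign (n : Z) (eps : Z -> sign) : Prop :=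
  forall i, eps (i + n) = eps i.

(* [f] is n-periodic with increment [m] over a period; its slope is [m / n]. *)
Definition periodic_function_by (n : Z) (m : R) (f : Z -> R) : Prop :=
  forall i, (m = f (i + n)%Z - f i)%R.

Definition periodic_function (n : Z) (f : Z -> R) : Prop :=
  exists m : R, periodic_function_by n m f.

(* The points p_i are distinct, so the underlying set of an n-periodic poset is
   identified with Z through i |-> p_i, and the poset is given by its strict
   order: [lt i j] means p_i < p_j. *)
Definition periodic_poset (n : Z) (lt : relation Z) : Prop :=
  StrictOrder lt /\ forall i j, lt i j <-> lt (i + n) (j + n).

Definition child (lt : relation Z) (p q : Z) : Prop :=
  lt p q /\ ~ exists x, lt p x /\ lt x q.

Definition parent (lt : relation Z) (q p : Z) : Prop := child lt p q.

(* The directed edges of the Hasse diagram of [lt] are the pairs (p, q) with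
   [child lt p q], so directed paths are given by the transitive closure. *)
Definition hasse_generates (lt : relation Z) : Prop :=
  forall p q, lt p q -> clos_trans Z (child lt) p q.

(* "[right_parent lt q p]" reads "q is a right parent of p", and likewise for
   the other three; left and right refer to the order of the indices. *)
Definition right_parent (lt : relation Z) (q p : Z) : Prop :=
  p < q /\ parent lt q p.
Definition left_parent (lt : relation Z) (q p : Z) : Prop :=
  q < p /\ parent lt q p.
Definition right_child (lt : relation Z) (q p : Z) : Prop :=
  p < q /\ child lt q p.
Definition left_child (lt : relation Z) (q p : Z) : Prop :=
  q < p /\ child lt q p.

Definition adjacent (lt : relation Z) (p q : Z) : Prop :=
  child lt p q \/ child lt q p.

(* The edge written (p_i, p_j), with i < j, of either slope. *)
Definition edge (lt : relation Z) (i j : Z) : Prop :=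
  i < j /\ adjacent lt i j.

Definition connected_graph (E : relation Z) : Prop :=
  forall p q, clos_refl_trans Z E p q.

(* [Sorted E] only constrains consecutive entries: it says that the list is a
   walk for [E].  A cycle x, l_1, ..., l_k, x has at least three vertices. *)
Definition simple_cycle (E : relation Z) (x : Z) (l : list Z) : Prop :=
  (2 <= length l)%nat /\ NoDup (x :: l) /\ Sorted E (x :: l ++ [x]).

Definition acyclic_graph (E : relation Z) : Prop :=
  forall x l, ~ simple_cycle E x l.

Definition tree_graph (E : relation Z) : Prop :=
  connected_graph E /\ acyclic_graph E.

(* A tree is determined by the partial order it defines on the indices, and is
   represented by that order. *)
Record periodic_tree (n : Z) (eps : Z -> sign) (lt : relation Z) : Prop := {
  pt_poset : periodic_poset n lt;
  pt_hasse : hasse_generates lt;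
  pt_tree : tree_graph (adjacent lt);
  pt_T1 : forall i,
    uniqueness (fun q => left_parent lt q i) /\
    uniqueness (fun q => right_parent lt q i) /\
    uniqueness (fun q => left_child lt q i) /\
    uniqueness (fun q => right_child lt q i);
  pt_T2 : forall i, eps i = Plus -> uniqueness (fun q => parent lt q i);
  pt_T3 : forall i, eps i = Minus -> uniqueness (fun q => child lt q i);
  pt_T4 : forall i j k, edge lt i j -> i < k < j ->
    (lt k i /\ lt k j -> eps k = Plus) /\
    (lt i k /\ lt j k -> eps k = Minus)
}.

Definition periodic_morphism (n : Z) (lt : relation Z) (psi : Z -> R) : Prop :=
  periodic_function n psi /\
  forall i j, lt i j -> (psi i < psi j)%R.

(* Main.v *)
Require Import Defs.
From Stdlib Require Import ZArith Reals Relations.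
From Stdlib Require Import RelationClasses List Sorted Classical Lia Lra.
Import ListNotations.
Local Open Scope Z_scope.

(** Place p_i at the point (i, pi i) of the plane.  Let every point of sign
    Minus emit a vertical wall upwards and every point of sign Plus a vertical
    wall downwards.  The tree consists of the strands that flow upwards between
    the walls: two strands merge at a Plus point, one strand splits at a Minus
    point.  Whether x and y are joined by such a flow is governed by the
    relation [wall_free]: the open vertical strip between x and y contains no
    wall at a height between those of x and y.

    Existence.  The order is the transitive closure of [wall_free].  Since the
    slope is nonzero, only finitely many points lie between two given heights
    ([periodic_finite_intervals]), so every relation is witnessed by a path in
    the Hasse diagram.  Edges are themselves wall-free, which is condition [pt_T4].
    If u has two parents p and q, with p the lower, then the two wall-free
    strips leave nothing that could stop the flow from p to q, which would give
    u < p < q, except when u is a Minus point between p and q ([climb],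
    [strand_parents]); this is [pt_T1], [pt_T2] and [pt_T3].  Neighbouring indices have no index
    between them, hence are always comparable, and the graph is connected.

    Uniqueness.  The engine is a statement about any order satisfying these conditions:
    a walk without backtracking that leaves a Plus point v through its left
    child stays to the left of v for ever ([branch_keeps_side]).  Indeed, while
    the walk descends it cannot jump over v by [pt_T4]; and when it turns upwards
    at u, then u is a Minus point with a parent on each side, the parent the
    walk came from must be the right one, and by induction the rest of the walk
    stays to the left of u.  Consequently a walk that starts upwards either
    ascends all the way or has, at its first turn, a Plus point whose index
    lies strictly between those of its two ends ([climbing_walk]).  From this
    follow acyclicity, the fact that all edges are wall-free
    ([edge_wall_free]), and the fact that wall-free pairs are related
    ([wall_free_in_tree]).  So every tree carrying the morphism has the
    transitive closure of [wall_free] as its order.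

    All conditions are symmetric under reversing the order of the indices and
    under turning the picture upside down while exchanging the signs.  The
    index order and the height order are therefore kept as parameters, and the
    symmetries are transpositions of relations. *)

(** * The two symmetries *)

Definition opposite (s : sign) : sign :=
  match s with Plus => Minus | Minus => Plus end.

Definition opposite_signs (eps : Z -> sign) : Z -> sign :=
  fun i => opposite (eps i).

Record linear_order (R : relation Z) : Prop := {
  linear_strict : StrictOrder R;
  linear_total : forall x y, R x y \/ x = y \/ R y x
}.

Definition between (ix : relation Z) (x k y : Z) : Prop :=
  (ix x k /\ ix k y) \/ (ix y k /\ ix k x).

Lemma linear_order_transp R : linear_order R -> linear_order (transp Z R).
Proof.
  intros [[irr tr] tot]; split; [split|]; unfold transp.
  - intros x; apply irr.
  - intros x y z hxy hyz; exact (tr _ _ _ hyz hxy).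
  - intros x y; destruct (tot x y) as [h | [h | h]]; auto.
Qed.

Lemma between_sym ix x k y : between ix x k y -> between ix y k x.
Proof. unfold between; tauto. Qed.

Lemma between_transp ix x k y :
  between (transp Z ix) x k y <-> between ix x k y.
Proof. unfold between, transp; tauto. Qed.

Lemma between_neq ix x k y :
  StrictOrder ix -> between ix x k y -> k <> x /\ k <> y.
Proof.
  intros [irr _] h; split; intros ->;
    destruct h as [[h1 h2] | [h1 h2]]; solve [eapply irr; eauto].
Qed.

(** Used with u a common neighbour of x and y, to transfer what the edges at u
    say about the points near u to the points between x and y. *)
Lemma between_split ix x k y u :
  linear_order ix -> between ix x k y ->
  between ix u k x \/ k = u \/ between ix u k y.
Proof.
  intros [_ tot] h; unfold between in *.
  destruct (tot k u) as [hk | [hk | hk]]; tauto.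
Qed.

Lemma between_trans ix x v k y :
  StrictOrder ix -> between ix k v x -> between ix x k y -> between ix x v y.
Proof.
  intros [irr tr] [[h1 h2] | [h1 h2]] [[h3 h4] | [h3 h4]];
    try (exfalso; eapply irr; eauto; fail).
  - right; split; eauto.
  - left; split; eauto.
Qed.

Lemma child_transp lt x y : child (transp Z lt) x y <-> child lt y x.
Proof.
  unfold child, transp; split; intros [h hn]; split; auto;
    intros [z [h1 h2]]; apply hn; exists z; auto.
Qed.

Lemma adjacent_sym lt x y : adjacent lt x y -> adjacent lt y x.
Proof. unfold adjacent; tauto. Qed.

Lemma adjacent_transp lt x y : adjacent (transp Z lt) x y <-> adjacent lt x y.
Proof. unfold adjacent; rewrite !child_transp; tauto. Qed.

(** The local conditions [pt_T1] to [pt_T4], stated for an arbitrary order of the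
    indices so that both symmetries preserve them.  The first three are
    merged: two distinct children can only hang on opposite sides of a Plus
    point, two distinct parents on opposite sides of a Minus point. *)
Record planar_tree (ix lt : relation Z) (eps : Z -> sign) : Prop := {
  planar_index : linear_order ix;
  planar_order : StrictOrder lt;
  planar_hasse : hasse_generates lt;
  planar_children : forall u p q, child lt p u -> child lt q u -> p <> q ->
    eps u = Plus /\ between ix p u q;
  planar_parents : forall u p q, child lt u p -> child lt u q -> p <> q ->
    eps u = Minus /\ between ix p u q;
  planar_below : forall x y k, adjacent lt x y -> between ix x k y ->
    lt k x -> lt k y -> eps k = Plus;
  planar_above : forall x y k, adjacent lt x y -> between ix x k y ->
    lt x k -> lt y k -> eps k = Minus
}.

Lemma planar_tree_reflect ix lt eps :
  planar_tree ix lt eps -> planar_tree (transp Z ix) lt eps.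
Proof.
  intros [hix hlt hh hc hp hb ha]; split; auto.
  - now apply linear_order_transp.
  - intros u p q; rewrite between_transp; auto.
  - intros u p q; rewrite between_transp; auto.
  - intros x y k; rewrite between_transp; eauto.
  - intros x y k; rewrite between_transp; eauto.
Qed.

Lemma clos_trans_transp (R S : relation Z) x y :
  (forall a b, R a b -> S b a) -> clos_trans Z R x y -> clos_trans Z S y x.
Proof.
  intros h; induction 1 as [a b hab | a b c _ IH1 _ IH2].
  - apply t_step; auto.
  - exact (t_trans _ _ _ _ _ IH2 IH1).
Qed.

Lemma planar_tree_dual ix lt eps :
  planar_tree ix lt eps ->
  planar_tree ix (transp Z lt) (opposite_signs eps).
Proof.
  intros [hix [irr tr] hh hc hp hb ha]; unfold opposite_signs; split; auto.
  - split.
    + intros x; apply irr.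
    + intros x y z hxy hyz; exact (tr _ _ _ hyz hxy).
  - intros p q hpq; apply clos_trans_transp with (R := child lt).
    + intros a b; apply child_transp.
    + now apply hh.
  - intros u p q; rewrite !child_transp; intros h1 h2 hn.
    destruct (hp u p q h1 h2 hn) as [-> hu]; auto.
  - intros u p q; rewrite !child_transp; intros h1 h2 hn.
    destruct (hc u p q h1 h2 hn) as [-> hu]; auto.
  - intros x y k; rewrite adjacent_transp; intros h1 h2 h3 h4.
    now rewrite (ha x y k h1 h2 h3 h4).
  - intros x y k; rewrite adjacent_transp; intros h1 h2 h3 h4.
    now rewrite (hb x y k h1 h2 h3 h4).
Qed.

(** * Walks without backtracking *)

(** The walk goes from [w] to the last argument, and [u] is its first step.  The
    first step is recorded because the arguments below depend on the branch
    through which a walk leaves its origin.  Only immediate reversals are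
    excluded, so that walks can be shortened and extended one step at a
    time. *)
Inductive reduced_walk (E : relation Z) (w u : Z) : Z -> Prop :=
| reduced_edge : E w u -> reduced_walk E w u u
| reduced_step b y : E w u -> b <> w -> reduced_walk E u b y ->
    reduced_walk E w u y.

Lemma reduced_walk_first E w u y : reduced_walk E w u y -> E w u.
Proof. now destruct 1. Qed.

Lemma reduced_walk_mono (E F : relation Z) w u y :
  (forall a b, E a b -> F a b) -> reduced_walk E w u y -> reduced_walk F w u y.
Proof.
  intros h; induction 1 as [w u hE | w u b y hE hb _ IH].
  - apply reduced_edge; auto.
  - apply reduced_step with b; auto.
Qed.

(** When the new edge reverses the last step, that step is deleted instead; the
    first step [u] survives unless the whole walk was [w], [u] and the new end
    is [w]. *)
Lemma reduced_walk_extend E w u x y :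
  reduced_walk E w u x -> E x y -> w <> y -> reduced_walk E w u y.
Proof.
  intros hw hE.
  assert (reduced_walk E w u y \/ (x = u /\ y = w)) as h.
  { induction hw as [w u h | w u b x h hb hr IH].
    - destruct (Z.eq_dec y w) as [-> | hy]; [now right | left].
      apply reduced_step with y; auto.
      now apply reduced_edge.
    - left; destruct (IH hE) as [h' | [-> ->]].
      + now apply reduced_step with b.
      + now apply reduced_edge. }
  intros hn; destruct h as [h | [_ ->]]; congruence.
Qed.

Lemma connected_reduced_walk (E : relation Z) x y :
  clos_refl_trans Z E x y -> x <> y -> exists u, reduced_walk E x u y.
Proof.
  intros h; apply clos_rt_rt1n in h.
  induction h as [x | x z y hE _ IH]; [congruence | intros hn].
  destruct (Z.eq_dec z y) as [<- | hz].
  - exists z; now apply reduced_edge.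
  - destruct (IH hz) as [u hu].
    destruct (Z.eq_dec u x) as [-> | hu'].
    + destruct hu as [_ | b y _ _ hr]; [congruence | now exists b].
    + exists z; now apply reduced_step with u.
Qed.

(** * Walks in a planar tree *)

(** Everything on a descent from the left child [a] is below [v], so an edge
    jumping over [v] would have the Plus point [v] above both its ends,
    which [pt_T4] forbids. *)
Lemma descent_keeps_side ix lt eps v a z :
  planar_tree ix lt eps -> eps v = Plus -> child lt a v -> ix a v ->
  z = a \/ lt z a -> ix z v.
Proof.
  intros T hv hav ha hz.
  destruct (planar_index _ _ _ T) as [_ tot].
  destruct (planar_order _ _ _ T) as [irr tr].
  enough (lt z v /\ ix z v) by tauto.
  destruct hz as [-> | hz]; [split; [apply hav | exact ha] |].
  apply (planar_hasse _ _ _ T), clos_trans_t1n in hz.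
  assert (forall x y, child lt x y -> lt y v /\ ix y v -> lt x v /\ ix x v)
    as step.
  { intros x y hxy [hyv hy].
    assert (lt x v) as hxv by exact (tr _ _ _ (proj1 hxy) hyv).
    split; [exact hxv |].
    destruct (tot x v) as [h | [-> | h]]; auto.
    - now destruct (irr v hxv).
    - assert (eps v = Minus); [| congruence].
      apply (planar_above _ _ _ T x y); auto.
      + now left.
      + now right. }
  induction hz as [z a hza | z y a hzy _ IH]; apply (step _ _ ltac:(eassumption));
    auto.
  split; [apply hav | exact ha].
Qed.

(** The induction behind [branch_keeps_side]: the walk has so far descended
    from [v] through [a] and is about to step from [w] to [u]. *)
Lemma branch_keeps_side_from ix lt eps v a w u y :
  planar_tree ix lt eps -> eps v = Plus -> child lt a v -> ix a v ->
  u = a \/ lt u a -> child lt u w -> w = v \/ lt w v ->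
  reduced_walk (adjacent lt) w u y -> ix y v.
Proof.
  intros T hv hav ha hua huw hwv hr.
  revert ix lt eps v a T hv hav ha hua huw hwv hr.
  (* The walk is taken in an unrelated [E], as the induction hypothesis is also
     needed for the picture turned upside down. *)
  assert (forall E : relation Z, reduced_walk E w u y ->
    forall ix lt eps v a, (forall x y, E x y -> adjacent lt x y) ->
    planar_tree ix lt eps -> eps v = Plus -> child lt a v -> ix a v ->
    u = a \/ lt u a -> child lt u w -> w = v \/ lt w v -> ix y v) as main.
  2: { intros ix lt eps v a T hv hav ha hua huw hwv hr.
       now apply (main (adjacent lt) hr ix lt eps v a). }
  intros E hr.
  induction hr as [w u _ | w u b y _ hb hr IH];
    intros ix lt eps v a hE T hv hav ha hua huw hwv;
    pose proof (descent_keeps_side ix lt eps v a u T hv hav ha hua) as hu;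
    [exact hu |].
  pose proof (planar_order _ _ _ T) as [irr tr].
  destruct (planar_index _ _ _ T) as [[ixirr ixtr] _].
  destruct (hE _ _ (reduced_walk_first _ _ _ _ hr)) as [hub | hbu].
  - (* The walk turns upwards at [u], to its second parent [b]. *)
    destruct (planar_parents _ _ _ T u w b) as [hum hbt]; auto.
    pose proof (planar_tree_dual _ _ _ T) as T'.
    assert (opposite_signs eps u = Plus) as hum'
      by (unfold opposite_signs; now rewrite hum).
    destruct hbt as [[hwu _] | [hbu _]].
    + (* If [w] were the left parent of [u], the ascent from [u] through [w] to
         [v] would stay to the left of [u], but [u] is to the left of [v]. *)
      exfalso; apply (ixirr v), (ixtr _ u); auto.
      apply (descent_keeps_side ix (transp Z lt) (opposite_signs eps) u w); auto.
      * now apply child_transp.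
      * destruct hwv; [left | right]; auto.
    + apply (ixtr _ u); auto.
      apply (IH ix (transp Z lt) (opposite_signs eps) u b); auto.
      * intros c d hcd; apply adjacent_transp; auto.
      * now apply child_transp.
      * now apply child_transp.
  - apply (IH ix lt eps v a); auto.
    + right; destruct hua as [-> | hua]; [apply hbu |].
      exact (tr _ _ _ (proj1 hbu) hua).
    + right; destruct hwv as [<- | hwv]; [apply huw |].
      exact (tr _ _ _ (proj1 huw) hwv).
Qed.

Lemma branch_keeps_side ix lt eps v a y :
  planar_tree ix lt eps -> eps v = Plus -> child lt a v -> ix a v ->
  reduced_walk (adjacent lt) v a y -> ix y v.
Proof.
  intros T hv hav ha hr.
  apply (branch_keeps_side_from ix lt eps v a v a); auto.
Qed.

(** The first turn of the walk is a Plus point [v] reached through one child and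
    left through the other, [a]; the two ends lie in these two branches, hence
    on opposite sides of [v]. *)
Lemma climbing_walk ix lt eps w u y :
  planar_tree ix lt eps -> child lt w u -> reduced_walk (adjacent lt) w u y ->
  lt w y \/
  exists v a, eps v = Plus /\ lt w v /\ child lt a v /\
    between ix w v y /\ reduced_walk (adjacent lt) v a y.
Proof.
  intros T hwu hr.
  pose proof (planar_order _ _ _ T) as [irr tr].
  (* [s] is where the ascent started, [w] the point reached so far. *)
  enough (forall s, s = w \/ lt s w -> lt s y \/
    exists v a, eps v = Plus /\ lt s v /\ child lt a v /\
    between ix s v y /\ reduced_walk (adjacent lt) v a y) as h by auto.
  induction hr as [w u _ | w u b y _ hb hr IH]; intros s hs;
    (assert (lt s u) as hsu;
      [destruct hs as [-> | hs];
        [apply hwu | exact (tr _ _ _ hs (proj1 hwu))] |]);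
    [now left |].
  destruct (reduced_walk_first _ _ _ _ hr) as [hub | hbu]; [now apply IH; auto |].
  right; exists u, b.
  destruct (planar_children _ _ _ T u w b) as [hu hbt]; auto.
  refine (conj hu (conj hsu (conj hbu (conj _ hr)))).
  pose proof (planar_tree_reflect _ _ _ T) as T'.
  destruct hbt as [[h1 h2] | [h1 h2]]; [left | right]; split.
  - now apply (descent_keeps_side ix lt eps u w).
  - now apply (branch_keeps_side (transp Z ix) lt eps u b).
  - now apply (branch_keeps_side ix lt eps u b).
  - now apply (descent_keeps_side (transp Z ix) lt eps u w).
Qed.

Lemma descending_walk ix lt eps w u y :
  planar_tree ix lt eps -> child lt u w -> reduced_walk (adjacent lt) w u y ->
  lt y w \/ exists v, eps v = Minus /\ lt v w /\ between ix w v y.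
Proof.
  intros T huw hr.
  destruct (climbing_walk ix (transp Z lt) (opposite_signs eps) w u y)
    as [h | (v & a & hv & hwv & _ & hbt & _)]; auto.
  - now apply planar_tree_dual.
  - now apply child_transp.
  - revert hr; apply reduced_walk_mono; intros; now apply adjacent_transp.
  - right; exists v; repeat split; auto.
    revert hv; unfold opposite_signs; now destruct (eps v).
Qed.

(** By [climbing_walk] and [descending_walk], a closed walk would put its origin
    below or above itself, or have a turn strictly between two equal indices. *)
Lemma no_closed_reduced_walk ix lt eps w u :
  planar_tree ix lt eps -> ~ reduced_walk (adjacent lt) w u w.
Proof.
  intros T hr.
  pose proof (planar_order _ _ _ T) as [irr _].
  destruct (planar_index _ _ _ T) as [hix _].
  assert (forall v, ~ between ix w v w) as hb.
  { intros v h; destruct hix as [ixirr ixtr].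
    destruct h as [[h1 h2] | [h1 h2]]; exact (ixirr _ (ixtr _ _ _ h1 h2)). }
  destruct (reduced_walk_first _ _ _ _ hr) as [h | h].
  - destruct (climbing_walk ix lt eps w u w T h hr)
      as [hw | (v & a & _ & _ & _ & hbt & _)].
    + exact (irr _ hw).
    + exact (hb _ hbt).
  - destruct (descending_walk ix lt eps w u w T h hr) as [hw | (v & _ & _ & hbt)].
    + exact (irr _ hw).
    + exact (hb _ hbt).
Qed.

Lemma simple_cycle_reduced_walk E x l :
  simple_cycle E x l -> exists u, reduced_walk E x u x.
Proof.
  intros (hl & hnd & hs).
  destruct l as [| u [| b l]]; simpl in hl; try lia.
  (* The origin [w] moves along the cycle while the end [x] stays fixed; [x = w]
     holds at the start only, and then the walk has a third vertex. *)
  assert (forall l w u, Sorted E (w :: u :: l ++ [x]) -> NoDup (w :: u :: l) ->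
    (x = w -> l <> []) -> ~ In x (u :: l) -> reduced_walk E w u x) as main.
  { clear; induction l as [| b l IH]; intros w u hs hnd hx hin; simpl in hs.
    - apply Sorted_inv in hs as [hs h1]; apply HdRel_inv in h1.
      apply Sorted_inv in hs as [_ h2]; apply HdRel_inv in h2.
      apply reduced_step with x; auto; [now intros -> ; apply hx |].
      now apply reduced_edge.
    - apply Sorted_inv in hs as [hs h1]; apply HdRel_inv in h1.
      apply NoDup_cons_iff in hnd as [hw hnd].
      apply reduced_step with b; auto.
      + intros ->; apply hw; simpl; auto.
      + apply IH; auto.
        * intros ->; destruct hin; simpl; auto.
        * intros h; apply hin; right; auto. }
  exists u; apply (main (b :: l)); auto; try easy.
  now apply NoDup_cons_iff in hnd.
Qed.

Lemma planar_tree_acyclic ix lt eps :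
  planar_tree ix lt eps -> acyclic_graph (adjacent lt).
Proof.
  intros T x l h.
  destruct (simple_cycle_reduced_walk _ _ _ h) as [u hu].
  exact (no_closed_reduced_walk ix lt eps x u T hu).
Qed.

(** * Edges are the wall-free pairs *)

(** The wall below a Plus point misses the heights between [x] and [y] exactly
    when the point is below [x]; dually for the wall above a Minus point. *)
Definition wall_free (ix ht : relation Z) (eps : Z -> sign) (x y : Z) : Prop :=
  ht x y /\ forall k, between ix x k y ->
    match eps k with Plus => ht k x | Minus => ht y k end.

Lemma wall_free_dual ix ht eps x y :
  wall_free ix (transp Z ht) (opposite_signs eps) x y <->
  wall_free ix ht eps y x.
Proof.
  unfold wall_free, opposite_signs, transp; split; intros [h hk]; split; auto;
    intros k hb; apply between_sym in hb; specialize (hk k hb);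
    now destruct (eps k).
Qed.

(** A walk to [x] extends to a walk to [y] with the same first step, so both ends
    of the edge would be on the side of [u], although [k] is between them. *)
Lemma edge_not_in_lower_branch ix lt eps x y k u :
  planar_tree ix lt eps -> adjacent lt x y -> between ix x k y ->
  eps k = Plus -> child lt u k -> ~ reduced_walk (adjacent lt) k u x.
Proof.
  intros T hxy hb hk huk hr.
  destruct (planar_index _ _ _ T) as [hix tot].
  assert (reduced_walk (adjacent lt) k u y) as hr'.
  { apply reduced_walk_extend with x; auto.
    now apply (between_neq ix x k y). }
  pose proof (planar_order _ _ _ T) as [irr _].
  destruct hix as [ixirr ixtr].
  destruct (tot u k) as [h | [-> | h]].
  - pose proof (branch_keeps_side ix lt eps k u x T hk huk h hr) as h1.
    pose proof (branch_keeps_side ix lt eps k u y T hk huk h hr') as h2.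
    destruct hb as [[h3 h4] | [h3 h4]]; eapply ixirr; eauto.
  - exact (irr _ (proj1 huk)).
  - pose proof (planar_tree_reflect _ _ _ T) as T'.
    pose proof (branch_keeps_side _ lt eps k u x T' hk huk h hr) as h1.
    pose proof (branch_keeps_side _ lt eps k u y T' hk huk h hr') as h2.
    unfold transp in h1, h2.
    destruct hb as [[h3 h4] | [h3 h4]]; eapply ixirr; eauto.
Qed.

(** A walk from [k] to [x] must start upwards by [edge_not_in_lower_branch].  If
    it turned at [v], then [v] would again be a Plus point between [x] and [y]
    with a lower branch leading to [x], against the same lemma. *)
Lemma plus_below_edge ix lt eps x y k :
  planar_tree ix lt eps -> connected_graph (adjacent lt) ->
  adjacent lt x y -> between ix x k y -> eps k = Plus -> lt k x.
Proof.
  intros T hconn hxy hb hk.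
  destruct (planar_index _ _ _ T) as [hix tot].
  destruct (connected_reduced_walk _ k x (hconn k x)) as [u hu].
  { now apply (between_neq ix x k y). }
  destruct (reduced_walk_first _ _ _ _ hu) as [hku | huk].
  - destruct (climbing_walk ix lt eps k u x T hku hu)
      as [h | (v & a & hv & hkv & hav & hvb & hr)]; auto.
    exfalso; apply (edge_not_in_lower_branch ix lt eps x y v a T hxy); auto.
    now apply between_trans with k.
  - exfalso; exact (edge_not_in_lower_branch ix lt eps x y k u T hxy hb hk huk hu).
Qed.

Lemma edge_wall_free ix lt ht eps x y :
  planar_tree ix lt eps -> connected_graph (adjacent lt) ->
  (forall i j, lt i j -> ht i j) -> child lt x y -> wall_free ix ht eps x y.
Proof.
  intros T hconn hht hxy; split; [apply hht, hxy | intros k hb].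
  destruct (eps k) eqn:hk; apply hht.
  - apply (plus_below_edge ix lt eps x y); auto.
    now left.
  - apply (plus_below_edge ix (transp Z lt) (opposite_signs eps) y x).
    + now apply planar_tree_dual.
    + intros p q; generalize (hconn p q).
      induction 1 as [a b h | a | a b c _ h1 _ h2].
      * apply rt_step, adjacent_transp; auto.
      * apply rt_refl.
      * now apply rt_trans with b.
    + apply adjacent_transp; now right.
    + now apply between_sym.
    + unfold opposite_signs; now rewrite hk.
Qed.

(** A walk from [x] to [y] which does not ascend throughout, nor descends
    throughout, has as its first turn a Plus point above [x] or a Minus point
    below [x], between [x] and [y]: its wall crosses the strip. *)
Lemma wall_free_in_tree ix lt ht eps x y :
  planar_tree ix lt eps -> connected_graph (adjacent lt) ->
  StrictOrder ht -> (forall i j, lt i j -> ht i j) ->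
  wall_free ix ht eps x y -> lt x y.
Proof.
  intros T hconn [irr tr] hht [hxy hk].
  destruct (connected_reduced_walk _ x y (hconn x y)) as [u hu].
  { intros ->; exact (irr _ hxy). }
  destruct (reduced_walk_first _ _ _ _ hu) as [h | h].
  - destruct (climbing_walk ix lt eps x u y T h hu)
      as [hw | (v & _ & hv & hxv & _ & hb & _)]; auto.
    exfalso; specialize (hk v hb); rewrite hv in hk.
    exact (irr _ (tr _ _ _ hk (hht _ _ hxv))).
  - exfalso; destruct (descending_walk ix lt eps x u y T h hu)
      as [hw | (v & hv & hvx & hb)].
    + exact (irr _ (tr _ _ _ hxy (hht _ _ hw))).
    + specialize (hk v hb); rewrite hv in hk.
      exact (irr _ (tr _ _ _ hxy (tr _ _ _ hk (hht _ _ hvx)))).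
Qed.

Lemma tree_order_unique ix lt ht eps x y :
  planar_tree ix lt eps -> connected_graph (adjacent lt) ->
  StrictOrder ht -> (forall i j, lt i j -> ht i j) ->
  lt x y <-> clos_trans Z (wall_free ix ht eps) x y.
Proof.
  intros T hconn hord hht; split; intros h.
  - apply (planar_hasse _ _ _ T) in h.
    induction h as [x y h | x y z _ h1 _ h2].
    + apply t_step; now apply edge_wall_free with lt.
    + now apply t_trans with y.
  - destruct (planar_order _ _ _ T) as [_ tr].
    induction h as [x y h | x y z _ h1 _ h2].
    + now apply wall_free_in_tree with ix ht eps.
    + exact (tr _ _ _ h1 h2).
Qed.

(** * Finiteness of the height intervals *)

Definition finite_intervals (ht : relation Z) : Prop :=
  forall u v, exists l, forall w, ht u w -> ht w v -> In w l.

Lemma interval_induction ht (P : Z -> Z -> Prop) :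
  StrictOrder ht -> finite_intervals ht ->
  (forall u v, (forall k, ht u k -> ht k v -> P u k /\ P k v) -> P u v) ->
  forall u v, P u v.
Proof.
  intros [irr tr] hfin hP.
  enough (forall N l u v, (length l < N)%nat ->
    (forall w, ht u w -> ht w v -> In w l) -> P u v) as main.
  { intros u v; destruct (hfin u v) as [l hl].
    apply (main (S (length l)) l); auto. }
  induction N as [| N IH]; intros l u v hl hin; [lia |].
  apply hP; intros k huk hkv.
  pose proof (remove_length_lt Z.eq_dec l k (hin k huk hkv)) as hlen.
  split; apply (IH (remove Z.eq_dec k l)); try lia;
    intros w h1 h2; apply in_in_remove.
  - intros ->; exact (irr _ h2).
  - apply hin; auto; exact (tr _ _ _ h2 hkv).
  - intros ->; exact (irr _ h1).
  - apply hin; auto; exact (tr _ _ _ huk h1).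
Qed.

Lemma lowest_in_interval ht (P : Z -> Prop) :
  StrictOrder ht -> finite_intervals ht ->
  forall u v k, ht u k -> ht k v -> P k ->
  exists b, ht u b /\ ht b v /\ P b /\ forall c, ht u c -> ht c b -> ~ P c.
Proof.
  intros hord hfin u v; pattern u, v; revert u v.
  refine (interval_induction ht _ hord hfin _).
  intros u v IH k huk hkv hPk.
  destruct (classic (exists c, ht u c /\ ht c k /\ P c)) as [(c & h1 & h2 & h3) | hn].
  - destruct (proj1 (IH k huk hkv) c h1 h2 h3) as (b & hub & hbk & hb).
    exists b; repeat split; try apply hb; auto.
    destruct hord as [_ tr]; exact (tr _ _ _ hbk hkv).
  - exists k; repeat split; auto.
    intros c h1 h2 h3; apply hn; eauto.
Qed.

(** Comparabilities are refined until no intermediate element is left, which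
    happens because a height interval is finite. *)
Lemma finite_hasse_generates ht lt :
  StrictOrder ht -> finite_intervals ht -> (forall i j, lt i j -> ht i j) ->
  hasse_generates lt.
Proof.
  intros hord hfin hht.
  intros u v; pattern u, v; revert u v.
  refine (interval_induction ht _ hord hfin _).
  intros u v IH huv.
  destruct (classic (exists x, lt u x /\ lt x v)) as [(x & h1 & h2) | hn].
  - destruct (IH x (hht _ _ h1) (hht _ _ h2)) as [h3 h4].
    apply t_trans with x; auto.
  - apply t_step; split; auto.
Qed.

(** * The order generated by the wall-free pairs *)

(** What the existence proof uses of the transitive closure of [wall_free]; in
    this form it is visibly invariant under the up-down symmetry. *)
Record strand_order (ix ht lt : relation Z) (eps : Z -> sign) : Prop := {
  strand_trans : Transitive lt;
  strand_wall_free : forall x y, wall_free ix ht eps x y -> lt x y;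
  strand_child : forall x y, child lt x y -> wall_free ix ht eps x y;
  strand_height : forall x y, lt x y -> ht x y
}.

Lemma strand_order_dual ix ht lt eps :
  strand_order ix ht lt eps ->
  strand_order ix (transp Z ht) (transp Z lt) (opposite_signs eps).
Proof.
  intros [tr hw hc hh]; split.
  - intros x y z h1 h2; exact (tr _ _ _ h2 h1).
  - intros x y h; now apply hw, wall_free_dual.
  - intros x y h; now apply wall_free_dual, hc, child_transp.
  - intros x y; apply hh.
Qed.

Lemma finite_intervals_transp ht :
  finite_intervals ht -> finite_intervals (transp Z ht).
Proof.
  intros h u v; destruct (h v u) as [l hl]; exists l; intros w h1 h2; now apply hl.
Qed.

(** No wall stands in the strip at the height of [u]: Plus points there are
    below [u] and Minus points above.  Higher up, the only obstacles to the flow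
    towards [v] are the Minus points [b] below [v].  The flow from [u] reaches
    the lowest of them freely, and the situation at [b] is again the one
    assumed at [u]. *)
Lemma climb ix ht lt eps :
  StrictOrder ix -> linear_order ht -> finite_intervals ht ->
  strand_order ix ht lt eps ->
  forall u v, ht u v ->
  (forall k, between ix u k v ->
    match eps k with Plus => ht k u | Minus => ht u k end) ->
  lt u v.
Proof.
  intros hix hht hfin S u v; pattern u, v; revert u v.
  destruct hht as [hord tot].
  refine (interval_induction ht _ hord hfin _).
  intros u v IH huv hk.
  destruct (classic (exists k, ht u k /\ ht k v /\ eps k = Minus /\ between ix u k v))
    as [(k & h1 & h2 & h3) | hn].
  - destruct (lowest_in_interval ht
      (fun k => eps k = Minus /\ between ix u k v) hord hfin u v k h1 h2 h3)
      as (b & hub & hbv & [hb hbb] & hlow).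
    assert (forall w, between ix u w b -> between ix u w v) as hsub1.
    { intros w hw; apply between_trans with b; auto; now apply between_sym. }
    assert (forall w, between ix b w v -> between ix u w v) as hsub2.
    { intros w hw; apply between_sym.
      apply between_trans with b; auto; now apply between_sym. }
    apply (strand_trans _ _ _ _ S _ b).
    + apply (strand_wall_free _ _ _ _ S); split; auto.
      intros w hw; specialize (hk w (hsub1 w hw)).
      destruct (eps w) eqn:hew; auto.
      destruct (tot w b) as [h | [-> | h]]; auto.
      * exfalso; exact (hlow w hk h (conj hew (hsub1 w hw))).
      * now destruct (proj2 (between_neq ix u b b hix hw)).
    + apply (proj2 (IH b hub hbv)); auto.
      intros w hw; specialize (hk w (hsub2 w hw)).
      destruct hord as [_ tr].
      destruct (eps w) eqn:hew; [exact (tr _ _ _ hk hub) |].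
      destruct (tot w b) as [h | [-> | h]]; auto.
      * exfalso; exact (hlow w hk h (conj hew (hsub2 w hw))).
      * now destruct (proj1 (between_neq ix b b v hix hw)).
  - apply (strand_wall_free _ _ _ _ S); split; auto.
    intros w hw; specialize (hk w hw).
    destruct (eps w) eqn:hew; auto.
    destruct (tot w v) as [h | [-> | h]]; auto.
    + exfalso; apply hn; eauto.
    + now destruct (proj2 (between_neq ix u v v hix hw)).
Qed.

(** With [p] the lower parent, a point between [p] and [q] is between [u] and one
    of them, or is [u].  In the first two cases the wall-free edges at [u] let
    the flow from [p] to [q] pass; so does [u] itself unless it is a Minus
    point.  As [q] is a parent of [u], the flow must be blocked. *)
Lemma strand_parents ix ht lt eps u p q :
  linear_order ix -> linear_order ht -> finite_intervals ht ->
  strand_order ix ht lt eps ->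
  child lt u p -> child lt u q -> p <> q ->
  eps u = Minus /\ between ix p u q.
Proof.
  intros hix hht hfin S.
  enough (forall p q, child lt u p -> child lt u q -> ht p q ->
    eps u = Minus /\ between ix p u q) as main.
  { intros hp hq hn.
    destruct (linear_total _ hht p q) as [h | [h | h]]; [auto | congruence |].
    destruct (main q p hq hp h); split; auto; now apply between_sym. }
  clear p q; intros p q hp hq hpq.
  apply NNPP; intros hn.
  apply (proj2 hq); exists p; split; [apply hp |].
  destruct (strand_child _ _ _ _ S _ _ hp) as [hup hwp].
  destruct (strand_child _ _ _ _ S _ _ hq) as [huq hwq].
  pose proof (linear_strict _ hht) as [_ tr].
  apply (climb ix ht lt eps); auto; [apply hix |].
  intros k hk.
  destruct (between_split ix p k q u hix hk) as [h | [-> | h]].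
  - specialize (hwp k h); destruct (eps k); auto.
    exact (tr _ _ _ hwp hup).
  - destruct (eps u) eqn:hu; auto.
    now destruct hn.
  - specialize (hwq k h); destruct (eps k).
    + exact (tr _ _ _ hwq hup).
    + exact (tr _ _ _ hpq hwq).
Qed.

Lemma strand_under_edge ix ht lt eps x y k :
  StrictOrder ht -> strand_order ix ht lt eps ->
  adjacent lt x y -> between ix x k y -> lt k x -> lt k y -> eps k = Plus.
Proof.
  intros [irr tr] S hxy hb hx hy.
  apply (strand_height _ _ _ _ S) in hx, hy.
  destruct (eps k) eqn:hk; auto; exfalso.
  destruct hxy as [h | h]; apply (strand_child _ _ _ _ S) in h as [_ h].
  - specialize (h k hb); rewrite hk in h; exact (irr _ (tr _ _ _ h hy)).
  - specialize (h k (between_sym _ _ _ _ hb)); rewrite hk in h.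
    exact (irr _ (tr _ _ _ h hx)).
Qed.

Lemma strand_planar_tree ix ht lt eps :
  linear_order ix -> linear_order ht -> finite_intervals ht ->
  strand_order ix ht lt eps -> planar_tree ix lt eps.
Proof.
  intros hix hht hfin S.
  pose proof (linear_order_transp _ hht) as hht'.
  pose proof (finite_intervals_transp _ hfin) as hfin'.
  pose proof (strand_order_dual _ _ _ _ S) as S'.
  assert (forall i, opposite_signs eps i = Minus -> eps i = Plus) as hm
    by (intros i; unfold opposite_signs; now destruct (eps i)).
  assert (forall i, opposite_signs eps i = Plus -> eps i = Minus) as hp
    by (intros i; unfold opposite_signs; now destruct (eps i)).
  split; auto.
  - split.
    + intros x hx; apply (strand_height _ _ _ _ S) in hx.
      destruct hht as [[irr _] _]; exact (irr _ hx).
    + apply (strand_trans _ _ _ _ S).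
  - apply (finite_hasse_generates ht); auto; [apply hht |].
    apply (strand_height _ _ _ _ S).
  - intros u p q h1 h2 hn.
    destruct (strand_parents ix (transp Z ht) (transp Z lt) (opposite_signs eps)
      u p q) as [hu hb]; auto; now apply child_transp.
  - intros u p q; now apply strand_parents with ht.
  - intros x y k; apply (strand_under_edge ix ht); auto; apply hht.
  - intros x y k h1 h2 h3 h4; apply hp.
    apply (strand_under_edge ix (transp Z ht) (transp Z lt) _ x y); auto.
    + apply hht'.
    + now apply adjacent_transp.
Qed.

(** An edge cannot be a composite of two relations, so it is one of the generating
    pairs. *)
Lemma wall_free_strand_order ix ht eps :
  StrictOrder ht ->
  strand_order ix ht (clos_trans Z (wall_free ix ht eps)) eps.
Proof.
  intros [_ tr]; split.
  - intros x y z; apply t_trans.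
  - intros x y; apply t_step.
  - intros x y [h hn]; destruct h as [y h | y z h1 h2]; auto.
    destruct hn; now exists y.
  - induction 1 as [x y h | x y z _ h1 _ h2]; [apply h | exact (tr _ _ _ h1 h2)].
Qed.

Lemma linear_order_Z : linear_order Z.lt.
Proof. split; [typeclasses eauto | intros x y; lia]. Qed.

(** There is no index between [i] and [i + 1], so one of the two is wall-free
    below the other. *)
Lemma strand_connected ht lt eps :
  linear_order ht -> finite_intervals ht -> strand_order Z.lt ht lt eps ->
  connected_graph (adjacent lt).
Proof.
  intros hht hfin S.
  pose proof (strand_planar_tree _ _ _ _ linear_order_Z hht hfin S) as T.
  assert (forall x y, lt x y -> clos_refl_trans Z (adjacent lt) x y /\
    clos_refl_trans Z (adjacent lt) y x) as hlt.
  { intros x y h; apply (planar_hasse _ _ _ T) in h.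
    induction h as [x y h | x y z _ [h1 h1'] _ [h2 h2']].
    - split; apply rt_step; [now left | now right].
    - split; now apply rt_trans with y. }
  assert (forall i, clos_refl_trans Z (adjacent lt) i (i + 1) /\
    clos_refl_trans Z (adjacent lt) (i + 1) i) as hstep.
  { intros i.
    destruct (linear_total _ hht i (i + 1)) as [h | [h | h]]; [| lia |].
    - apply hlt, (strand_wall_free _ _ _ _ S); split; auto.
      intros k [hk | hk]; lia.
    - apply and_comm, hlt, (strand_wall_free _ _ _ _ S); split; auto.
      intros k [hk | hk]; lia. }
  assert (forall i d, 0 <= d -> clos_refl_trans Z (adjacent lt) i (i + d) /\
    clos_refl_trans Z (adjacent lt) (i + d) i) as hd.
  { intros i; apply natlike_ind.
    - rewrite Z.add_0_r; split; apply rt_refl.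
    - intros d _ [h1 h2]; destruct (hstep (i + d)) as [h3 h4].
      replace (i + Z.succ d) with (i + d + 1) by lia.
      split; now apply rt_trans with (i + d). }
  intros p q; destruct (Z.le_ge_cases p q) as [h | h].
  - replace q with (p + (q - p)) by lia; apply hd; lia.
  - replace p with (q + (p - q)) by lia; apply hd; lia.
Qed.

(** * Periodicity *)

Lemma wall_free_shift ht eps s x y :
  (forall i, eps (i + s) = eps i) ->
  (forall i j, ht i j <-> ht (i + s) (j + s)) ->
  clos_trans Z (wall_free Z.lt ht eps) x y ->
  clos_trans Z (wall_free Z.lt ht eps) (x + s) (y + s).
Proof.
  intros heps hht; induction 1 as [x y [h hk] | x y z _ h1 _ h2].
  - apply t_step; split; [apply (hht x y), h |].
    intros k hb; specialize (hk (k - s)).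
    assert (between Z.lt x (k - s) y) as hb'
      by (destruct hb; [left | right]; lia).
    specialize (hk hb'); rewrite <- (heps (k - s)) in hk.
    pose proof (proj1 (hht (k - s) x)) as h1.
    pose proof (proj1 (hht y (k - s))) as h2.
    replace (k - s + s) with k in hk, h1, h2 by lia.
    destruct (eps k); auto.
  - now apply t_trans with (y + s).
Qed.

Lemma planar_tree_of_periodic n eps lt :
  periodic_tree n eps lt -> planar_tree Z.lt lt eps.
Proof.
  intros [[hord hper] hh htree h1 h2 h3 h4]; split; auto.
  - apply linear_order_Z.
  - intros u p q hp hq hn; split.
    + destruct (eps u) eqn:hu; auto.
      destruct hn; exact (h3 u hu p q hp hq).
    + destruct (h1 u) as (_ & _ & hl & hr).
      assert (p <> u /\ q <> u) as [hpu hqu].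
      { destruct hord as [irr _].
        split; intros ->; [exact (irr _ (proj1 hp)) | exact (irr _ (proj1 hq))]. }
      destruct (Z.lt_total p u) as [a | [a | a]]; [| lia |];
        (destruct (Z.lt_total q u) as [b | [b | b]]; [| lia |]).
      * destruct hn; now apply hl.
      * left; lia.
      * right; lia.
      * destruct hn; now apply hr.
  - intros u p q hp hq hn; split.
    + destruct (eps u) eqn:hu; auto.
      destruct hn; exact (h2 u hu p q hp hq).
    + destruct (h1 u) as (hl & hr & _ & _).
      assert (p <> u /\ q <> u) as [hpu hqu].
      { destruct hord as [irr _].
        split; intros ->; [exact (irr _ (proj1 hp)) | exact (irr _ (proj1 hq))]. }
      destruct (Z.lt_total p u) as [a | [a | a]]; [| lia |];
        (destruct (Z.lt_total q u) as [b | [b | b]]; [| lia |]).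
      * destruct hn; now apply hl.
      * left; lia.
      * right; lia.
      * destruct hn; now apply hr.
  - intros x y k hxy [[a b] | [a b]] hx hy.
    + now apply (h4 x y k); [split; [lia |] | |].
    + apply (h4 y x k); auto; split; [lia |]; now apply adjacent_sym.
  - intros x y k hxy [[a b] | [a b]] hx hy.
    + now apply (h4 x y k); [split; [lia |] | |].
    + apply (h4 y x k); auto; split; [lia |]; now apply adjacent_sym.
Qed.

Lemma periodic_of_planar_tree n eps lt :
  (forall i j, lt i j <-> lt (i + n) (j + n)) ->
  connected_graph (adjacent lt) -> planar_tree Z.lt lt eps ->
  periodic_tree n eps lt.
Proof.
  intros hper hconn T.
  pose proof (planar_tree_acyclic _ _ _ T) as hac.
  destruct T as [_ hord hh hc hp hb ha].
  split; auto.
  - now split.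
  - now split.
  - intros i; repeat split; intros p q [h1 h2] [h3 h4];
      destruct (Z.eq_dec p q) as [e | e]; auto; exfalso.
    + destruct (hp i p q h2 h4 e) as [_ [h | h]]; lia.
    + destruct (hp i p q h2 h4 e) as [_ [h | h]]; lia.
    + destruct (hc i p q h2 h4 e) as [_ [h | h]]; lia.
    + destruct (hc i p q h2 h4 e) as [_ [h | h]]; lia.
  - intros i hi p q h1 h2; destruct (Z.eq_dec p q) as [e | e]; auto.
    destruct (hp i p q h1 h2 e); congruence.
  - intros i hi p q h1 h2; destruct (Z.eq_dec p q) as [e | e]; auto.
    destruct (hc i p q h1 h2 e); congruence.
  - intros i j k [_ hij] hk; split; intros [h1 h2].
    + apply (hb i j); auto; now left.
    + apply (ha i j); auto; now left.
Qed.

(** * Periodic functions of nonzero slope *)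

Lemma periodic_function_multiple n m (f : Z -> R) i q :
  periodic_function_by n m f -> (f (i + n * q)%Z = f i + m * IZR q)%R.
Proof.
  intros hf.
  assert (forall d, 0 <= d -> forall i, (f (i + n * d)%Z = f i + m * IZR d)%R) as h.
  { apply (natlike_ind (fun d => forall i, (f (i + n * d)%Z = f i + m * IZR d)%R)).
    - intros j; rewrite Z.mul_0_r, Z.add_0_r; lra.
    - intros d _ IH j.
      replace (j + n * Z.succ d) with (j + n * d + n) by lia.
      specialize (hf (j + n * d)); rewrite IH in hf.
      rewrite succ_IZR; lra. }
  destruct (Z.le_ge_cases 0 q) as [hq | hq]; [now apply h |].
  specialize (h (- q) ltac:(lia) (i + n * q)).
  replace (i + n * q + n * - q) with i in h by lia.
  rewrite opp_IZR in h; lra.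
Qed.

Lemma bounded_on_initial_segment (f : Z -> R) n :
  0 <= n -> exists C, forall r, 0 <= r < n -> (Rabs (f r) <= C)%R.
Proof.
  revert n; apply natlike_ind.
  - exists 0%R; intros; lia.
  - intros n _ [C hC]; exists (Rmax C (Rabs (f n))); intros r hr.
    destruct (Z.eq_dec r n) as [-> | hn]; [apply Rmax_r |].
    apply Rle_trans with C; [apply hC; lia | apply Rmax_l].
Qed.

(** Writing w = n q + r, the value at w is that at r plus m q.  The values at the
    residues r are bounded, so a bound on the value at w bounds q. *)
Lemma periodic_finite_intervals n m (f : Z -> R) :
  0 < n -> m <> 0%R -> periodic_function_by n m f ->
  finite_intervals (fun i j => (f i < f j)%R).
Proof.
  intros hn hm hf u v.
  destruct (bounded_on_initial_segment f n ltac:(lia)) as [C hC].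
  set (K := up ((Rabs (f u) + Rabs (f v) + C) / Rabs m)).
  set (N := n * (Z.abs K + 1)).
  exists (map (fun k => Z.of_nat k - N) (seq 0 (Z.to_nat (2 * N + 1)))).
  intros w huw hwv.
  enough (- N <= w <= N) as hN.
  { apply in_map_iff; exists (Z.to_nat (w + N)); split; [lia |].
    apply in_seq; lia. }
  pose proof (Z.div_mod w n ltac:(lia)) as hw.
  pose proof (Z.mod_pos_bound w n hn) as hr.
  assert (f w = f (w mod n) + m * IZR (w / n))%R as hfw.
  { rewrite <- (periodic_function_multiple n m f _ _ hf); f_equal; lia. }
  specialize (hC _ hr).
  pose proof (Rabs_pos_lt m hm) as hm'.
  assert (Rabs (m * IZR (w / n)) <= Rabs (f u) + Rabs (f v) + C)%R as hq.
  { revert hC; unfold Rabs; repeat destruct Rcase_abs; lra. }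
  rewrite Rabs_mult, <- abs_IZR in hq.
  assert (IZR (Z.abs (w / n)) < IZR K)%R as hK.
  { apply Rle_lt_trans with ((Rabs (f u) + Rabs (f v) + C) / Rabs m)%R.
    - apply Rmult_le_reg_l with (Rabs m); auto.
      replace (Rabs m * ((Rabs (f u) + Rabs (f v) + C) / Rabs m))%R
        with (Rabs (f u) + Rabs (f v) + C)%R; [exact hq | field; lra].
    - apply (proj1 (archimed _)). }
  apply lt_IZR in hK.
  subst N; nia.
Qed.

(** * Existence and uniqueness *)

Theorem theorem1p5p1 (n : Z) (hn : 2 <= n)
  (eps : Z -> sign) (heps : periodic_sign n eps)
  (pi : Z -> R) (m : R) (hpi : periodic_function_by n m pi)
  (hslope : (m / IZR n <> 0)%R)
  (hdistinct : forall i j : Z, i <> j -> pi i <> pi j) :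
  exists lt : relation Z,
    (periodic_tree n eps lt /\ periodic_morphism n lt pi) /\
    forall lt' : relation Z,
      periodic_tree n eps lt' /\ periodic_morphism n lt' pi ->
      forall i j : Z, lt' i j <-> lt i j.
Proof.
  set (ht := fun i j => (pi i < pi j)%R).
  assert (linear_order ht) as hht.
  { split; [split |]; unfold ht.
    - intros x h; lra.
    - intros x y z h1 h2; lra.
    - intros x y; destruct (Z.eq_dec x y) as [h | h]; auto.
      apply hdistinct in h; lra. }
  assert (finite_intervals ht) as hfin.
  { apply (periodic_finite_intervals n m); auto; [lia |].
    intros ->; apply hslope; unfold Rdiv; lra. }
  pose proof (wall_free_strand_order Z.lt ht eps (linear_strict _ hht)) as S.
  exists (clos_trans Z (wall_free Z.lt ht eps)); split; [split |].
  - apply periodic_of_planar_tree.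
    + assert (forall i j, ht i j <-> ht (i + n) (j + n)) as hs.
      { intros i j; unfold ht; pose proof (hpi i); pose proof (hpi j); lra. }
      intros i j; split; intros h; [now apply wall_free_shift |].
      replace i with (i + n + - n) by lia.
      replace j with (j + n + - n) by lia.
      apply wall_free_shift; auto.
      * intros k; rewrite <- heps; f_equal; lia.
      * intros x y; rewrite (hs (x + - n)).
        now replace (x + - n + n) with x by lia;
          replace (y + - n + n) with y by lia.
    + now apply strand_connected with ht eps.
    + now apply strand_planar_tree with ht; [apply linear_order_Z | | |].
  - split; [now exists m |].
    apply (strand_height _ _ _ _ S).
  - intros lt' [T [_ hmor]] i j.
    apply tree_order_unique; auto; [| apply T | apply hht].
    now apply planar_tree_of_periodic with n.
Qed.
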